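(* Let $n\ge 2$ be even. For a function $f:\mathbb{F}_2^n\to\{0,1\}$ with $f(\mathbf{0})=0$ and $\mathbf{a}\in\mathbb{F}_2^n$ let $W_f(\mathbf{a})=\sum_{\mathbf{x}\in\mathbb{F}_2^n}(-1)^{f(\mathbf{x})+\mathbf{a}\cdot\mathbf{x}}$, and let $$L(f)=\sum_{\mathbf{a}\in\mathbb{F}_2^n}\Bigl(W_f(\mathbf{a})^4-4\,W_f(\mathbf{a})^3\Bigr).$$ Then the minimum value of $L(f)$ over all functions $f:\mathbb{F}_2^n\to\{0,1\}$ with $f(\mathbf{0})=0$ is $L_{\min}=2^{3n}-4\cdot 2^{2n}$, and $L$ attains this minimum whenever $f$ (with $f(\mathbf{0})=0$) is a bent function.
   Context: A function $f:\mathbb{F}_2^n\to\{0,1\}$ ($n$ even) is bent if $|W_f(\mathbf{a})|=2^{n/2}$ for all $\mathbf{a}\in\mathbb{F}_2^n$. $\mathbf{a}\cdot\mathbf{x}$ is the standard $\mathbb{F}_2$ inner product. *)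

(* Defs.v *)
From HB Require Import structures.
From mathcomp Require Import all_boot all_order all_algebra.

Set Implicit Arguments.
Unset Strict Implicit.
Unset Printing Implicit Defensive.

Import Order.TTheory GRing.Theory Num.Theory.
Local Open Scope ring_scope.

Definition dotF2 (n : nat) (a x : 'rV['F_2]_n) : 'F_2 :=
  \sum_(i < n) a 0 i * x 0 i.

(* In the exponent, f x : bool and dotF2 a x : 'F_2 are both read as the
   natural numbers 0 or 1, and the addition is that of nat. *)
Definition walsh (n : nat) (f : 'rV['F_2]_n -> bool) (a : 'rV['F_2]_n) : int :=
  \sum_(x : 'rV['F_2]_n) (-1) ^+ (f x + dotF2 a x)%N.

(* Meaningful only for even n, since n./2 is the integer part of n / 2. *)
Definition bent (n : nat) (f : 'rV['F_2]_n -> bool) : Prop :=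
  forall a : 'rV['F_2]_n, `|walsh f a| = 2 ^+ n./2.

Definition walsh_loss (n : nat) (f : 'rV['F_2]_n -> bool) : int :=
  \sum_(a : 'rV['F_2]_n) (walsh f a ^+ 4 - 4 * walsh f a ^+ 3).

(* Main.v *)
(** Write F = (-1)^f, let W be its Walsh transform and r(u) = sum_x F(x) F(x + u)
    its autocorrelation. Since W^2 is the transform of r, Parseval's identity gives
    L(f) = 2^n sum_u (r(u)^2 - 4 r(u) F(u)), and the term u = 0 of the sum is
    2^(2n) - 4 * 2^n. For u <> 0 the set of x with f(x) <> f(x + u) is invariant
    under translation by u, hence of even size, so r(u) = 4 k for an integer k;
    as F(u) is a sign, the term 16 k (k - F(u)) is nonnegative. When f is bent,
    W^4 = 2^(2n) and W^3 = 2^n W, and the sum of W is 2^n F(0). The inner product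
    function f(x, y) = x . y is bent. *)

Require Import Defs.
From HB Require Import structures.
From mathcomp Require Import all_boot all_order all_algebra.
From mathcomp Require Import ring zify.

Set Implicit Arguments.
Unset Strict Implicit.
Unset Printing Implicit Defensive.

Import Order.TTheory GRing.Theory Num.Theory.
Local Open Scope ring_scope.

Lemma addF2K (n : nat) (u : 'rV['F_2]_n) : involutive (+%R u).
Proof.
move=> x; apply/rowP => i; rewrite !mxE addrA.
suff -> : u 0 i + u 0 i = 0 by rewrite add0r.
by case: (u 0 i) => [[|[|k]]] // lt_k; apply/val_inj.
Qed.

Lemma addF2_eq0 (n : nat) (x y : 'rV['F_2]_n) : (x + y == 0) = (y == x).
Proof. by rewrite -(can_eq (addF2K x)) addF2K addr0. Qed.

Lemma F2_neq0 (t : 'F_2) : (t != 0) = (t == 1).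
Proof. by case: t => [[|[|k]]]. Qed.

(** The nontrivial additive character of F_2; the exponent [t] is read as the natural number 0 or
    1. *)
Definition chi (t : 'F_2) : int := (-1) ^+ t.

Lemma chiD (s t : 'F_2) : chi (s + t) = chi s * chi t.
Proof. by case: s t => [[|[|k]]] // ? [[|[|l]]]. Qed.

Lemma dotF2C (n : nat) (a x : 'rV['F_2]_n) : dotF2 a x = dotF2 x a.
Proof. by apply: eq_bigr => i _; rewrite mulrC. Qed.

Lemma dotF2Dr (n : nat) (a x y : 'rV['F_2]_n) :
  dotF2 a (x + y) = dotF2 a x + dotF2 a y.
Proof. by rewrite -big_split; apply: eq_bigr => i _; rewrite mxE mulrDr. Qed.

Lemma dotF2Dl (n : nat) (a b x : 'rV['F_2]_n) :
  dotF2 (a + b) x = dotF2 a x + dotF2 b x.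
Proof. by rewrite !(dotF2C _ x) dotF2Dr. Qed.

Lemma dotF20r (n : nat) (a : 'rV['F_2]_n) : dotF2 a 0 = 0.
Proof. by apply: big1 => i _; rewrite mxE mulr0. Qed.

Lemma dotF2_delta (n : nat) (i : 'I_n) (x : 'rV['F_2]_n) :
  dotF2 (delta_mx 0 i) x = x 0 i.
Proof.
rewrite /dotF2 (bigD1 i) //= mxE !eqxx mul1r big1 ?addr0 // => j /negPf ji.
by rewrite mxE ji mul0r.
Qed.

Lemma dotF2_row_mx (m k : nat) (a x : 'rV['F_2]_m) (b y : 'rV['F_2]_k) :
  dotF2 (row_mx a b) (row_mx x y) = dotF2 a x + dotF2 b y.
Proof.
rewrite /dotF2 big_split_ord /=; congr (_ + _); apply: eq_bigr => i _.
  by rewrite !row_mxEl.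
by rewrite !row_mxEr.
Qed.

Lemma rVF2_neq0 (n : nat) (x : 'rV['F_2]_n) : x != 0 -> exists i, x 0 i = 1.
Proof. by case/rV0Pn => i; rewrite F2_neq0 => /eqP; exists i. Qed.

Lemma card_rVF2 (n : nat) : #|{: 'rV['F_2]_n}| = (2 ^ n)%N.
Proof. by rewrite card_mx card_Fp // mul1n. Qed.

Lemma sum_chi (n : nat) (x : 'rV['F_2]_n) :
  \sum_a chi (dotF2 a x) = (x == 0)%:R * 2 ^+ n.
Proof.
have [->|/rVF2_neq0[i xi]] := eqVneq x 0.
  under eq_bigr => a _ do rewrite dotF20r.
  by rewrite mul1r sumr_const card_rVF2 natrX.
(* Translating [a] by the unit vector of a coordinate where [x] is 1 flips the sign of every
   term. *)
set S := \sum_a _; have: S = - S.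
  rewrite {1}/S (reindex_inj (addrI (delta_mx 0 i))) -sumrN.
  apply: eq_bigr => a _.
  by rewrite dotF2Dl chiD dotF2_delta xi mulN1r.
rewrite mul0r; lia.
Qed.

Definition fourier (n : nat) (g : 'rV['F_2]_n -> int) (a : 'rV['F_2]_n) : int :=
  \sum_x g x * chi (dotF2 a x).

(** Once the sum over [a] is innermost, it is a character sum at [x + y], which vanishes unless
    [y = x]. *)
Lemma parseval (n : nat) (g h : 'rV['F_2]_n -> int) :
  \sum_a fourier g a * fourier h a = 2 ^+ n * \sum_x g x * h x.
Proof.
under eq_bigr => a _ do rewrite /fourier big_distrlr /=.
rewrite exchange_big mulr_sumr; apply: eq_bigr => x _.
rewrite exchange_big (bigD1 x) //= [X in _ + X]big1 ?addr0 => [|y yx].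
  transitivity (\sum_a g x * h x * chi (dotF2 a (x + x))).
    by apply: eq_bigr => a _; rewrite dotF2Dr chiD; ring.
  by rewrite -mulr_sumr sum_chi addF2_eq0 eqxx mul1r mulrC.
transitivity (\sum_a g x * h y * chi (dotF2 a (x + y))).
  by apply: eq_bigr => a _; rewrite dotF2Dr chiD; ring.
by rewrite -mulr_sumr sum_chi addF2_eq0 (negPf yx) mul0r mulr0.
Qed.

(** Parseval against the indicator [d] of 0, whose transform is constantly 1. *)
Lemma sum_fourier (n : nat) (g : 'rV['F_2]_n -> int) :
  \sum_a fourier g a = 2 ^+ n * g 0.
Proof.
pose d (x : 'rV['F_2]_n) : int := (x == 0)%:R.
have sum_d (h : 'rV['F_2]_n -> int) : \sum_x d x * h x = h 0.
  rewrite (bigD1 0) //= big1 => [|x /negPf x0]; last by rewrite /d x0 mul0r.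
  by rewrite /d eqxx mul1r addr0.
rewrite -[g 0]sum_d -parseval; apply: eq_bigr => a _.
by rewrite [fourier d a]sum_d dotF20r mul1r.
Qed.

Definition autocorr (n : nat) (g : 'rV['F_2]_n -> int) (u : 'rV['F_2]_n) : int :=
  \sum_x g x * g (x + u).

Lemma fourier_autocorr (n : nat) (g : 'rV['F_2]_n -> int) (a : 'rV['F_2]_n) :
  fourier (autocorr g) a = fourier g a ^+ 2.
Proof.
rewrite expr2 {2 3}/fourier big_distrlr /= /fourier /autocorr.
under [LHS]eq_bigr => u _ do rewrite mulr_suml.
rewrite exchange_big; apply: eq_bigr => x _.
(* The shift becomes [x + y], so that [g (x + (x + y))] is [g y] and the double sum factors. *)
rewrite (reindex_inj (addrI x)); apply: eq_bigr => y _ /=.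
by rewrite addF2K dotF2Dr chiD; ring.
Qed.

Definition signf (n : nat) (f : 'rV['F_2]_n -> bool) (x : 'rV['F_2]_n) : int :=
  (-1) ^+ f x.

Lemma walshE (n : nat) (f : 'rV['F_2]_n -> bool) : walsh f =1 fourier (signf f).
Proof. by move=> a; apply: eq_bigr => x _; rewrite exprD. Qed.

Lemma walsh_lossE (n : nat) (f : 'rV['F_2]_n -> bool) (r := autocorr (signf f)) :
  walsh_loss f = 2 ^+ n * \sum_u (r u ^+ 2 - 4 * (r u * signf f u)).
Proof.
(* Parseval for [r] with itself yields the fourth powers, and for [r] with [signf f] the cubes. *)
rewrite sumrB -mulr_sumr mulrBr mulrCA -!parseval mulr_sumr -sumrB.
by apply: eq_bigr => a _; rewrite fourier_autocorr walshE; ring.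
Qed.

(** At a coordinate [i] where [u] is 1, translation by [u] exchanges the elements of [A] with entry
    0 and those with entry 1. *)
Lemma card_translation_even (n : nat) (u : 'rV['F_2]_n) (A : {set 'rV['F_2]_n}) :
  u != 0 -> (forall x, (u + x \in A) = (x \in A)) -> ~~ odd #|A|.
Proof.
case/rVF2_neq0 => i ui uA; rewrite -sum1_card.
rewrite (bigID (fun x : 'rV__ => x 0 i == 0)) /=.
rewrite [X in (_ + X)%N](reindex_inj (addrI u)) /=.
rewrite [X in (_ + X)%N](eq_bigl (fun x : 'rV__ => (x \in A) && (x 0 i == 0))).
  by rewrite addnn odd_double.
move=> x; rewrite uA mxE ui; congr (_ && _).
by case: (x 0 i) => [[|[|k]]].
Qed.

Lemma autocorr_signf (n : nat) (f : 'rV['F_2]_n -> bool) (u : 'rV['F_2]_n) :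
  autocorr (signf f) u = 2 ^+ n - 2 * #|[set x | f x != f (x + u)]|%:R.
Proof.
rewrite -sum1_card natr_sum big_mkcond /= mulr_sumr.
rewrite -natrX -card_rVF2 -sumr_const -sumrB; apply: eq_bigr => x _.
by rewrite /signf inE; case: (f x) (f (x + u)) => [] [].
Qed.

Lemma autocorr_signf_mod4 (n : nat) (f : 'rV['F_2]_n -> bool) (u : 'rV['F_2]_n) :
  (2 <= n)%N -> u != 0 -> exists k : int, autocorr (signf f) u = 4 * k.
Proof.
move=> n_ge2 u_neq0; rewrite autocorr_signf.
have -> : 2 ^+ n = 4 * 2 ^+ (n - 2) :> int by rewrite -{1}(subnKC n_ge2) exprD.
set A := [set _ | _].
have /even_halfK <- : ~~ odd #|A|.
  apply: (card_translation_even u_neq0) => x.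
  by rewrite !inE [u + x + u]addrC addF2K eq_sym addrC.
exists (2 ^+ (n - 2) - #|A|./2%:R).
rewrite -muln2 natrM; ring.
Qed.

Lemma walsh_loss_ge (n : nat) (f : 'rV['F_2]_n -> bool) :
  (2 <= n)%N -> f 0 = false ->
  2 ^+ (3 * n) - 4 * 2 ^+ (2 * n) <= walsh_loss f.
Proof.
move=> n_ge2 f0; rewrite walsh_lossE (bigD1 0) //=.
have -> : autocorr (signf f) 0 = 2 ^+ n.
  rewrite autocorr_signf (_ : [set _ | _] = set0) ?cards0 ?mulr0 ?subr0 //.
  by apply/setP => x; rewrite !inE addr0 eqxx.
rewrite /signf f0 ![(3 * n)%N]mulnC ![(2 * n)%N]mulnC !exprM expr0 mulr1.
rewrite mulrDr -[X in X <= _]addr0; apply: lerD.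
  by rewrite le_eqVlt; apply/orP; left; apply/eqP; ring.
rewrite mulr_ge0 ?exprn_ge0 ?sumr_ge0 // => u u_neq0.
have [k ->] := autocorr_signf_mod4 f n_ge2 u_neq0.
(* The term is 16 k (k + 1) if [f u] holds and 16 k (k - 1) otherwise: a product of consecutive
   integers is never negative. *)
case: (f u); rewrite (expr0, expr1).
  by have [k_ge0|k_lt0] := leP 0 k; nia.
by have [k_le0|k_gt0] := leP k 0; nia.
Qed.

Lemma bent_walsh_loss (n : nat) (f : 'rV['F_2]_n -> bool) :
  ~~ odd n -> f 0 = false -> bent f ->
  walsh_loss f = 2 ^+ (3 * n) - 4 * 2 ^+ (2 * n).
Proof.
move=> n_even f0 f_bent.
(* Evenness of [n] enters here, through [n./2 * 2 = n]. *)
have W2 a : walsh f a ^+ 2 = 2 ^+ n.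
  by rewrite -real_normK ?num_real // f_bent -exprM muln2 even_halfK.
transitivity (\sum_a (2 ^+ (2 * n) - 4 * 2 ^+ n * fourier (signf f) a)).
  apply: eq_bigr => a _.
  by rewrite -walshE [(2 * n)%N]mulnC exprM -(W2 a); ring.
rewrite sumrB sumr_const card_rVF2 -mulr_sumr sum_fourier /signf f0.
rewrite -[_ *+ (2 ^ n)%N]mulr_natr natrX.
by rewrite [(2 * n)%N]mulnC [(3 * n)%N]mulnC !exprM; ring.
Qed.

Lemma sum_row_mx (V : nmodType) (T : finType) (m k : nat)
    (G : 'rV[T]_(m + k) -> V) :
  \sum_x G x = \sum_x \sum_y G (row_mx x y).
Proof.
rewrite pair_big /= (reindex (fun p => row_mx p.1 p.2)) //=.
exists (fun x => (lsubmx x, rsubmx x)) => [[x y]|x] _ /=.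
  by rewrite row_mxKl row_mxKr.
exact: hsubmxK.
Qed.

Definition inner_product_fun (m : nat) (x : 'rV['F_2]_(m + m)) : bool :=
  dotF2 (lsubmx x) (rsubmx x) == 1.

(** With [a = (b, c)] and [x] fixed, the sum over [y] is a character sum at [x + c]; only [x = c]
    survives and leaves a sign times [2 ^+ m]. *)
Lemma inner_product_bent (m : nat) : bent (@inner_product_fun m).
Proof.
move=> a; rewrite walshE /fourier sum_row_mx -[a]hsubmxK.
set b := lsubmx a; set c := rsubmx a.
transitivity (`|\sum_x chi (dotF2 b x) * \sum_y chi (dotF2 y (x + c))|).
  congr `|_|; apply: eq_bigr => x _; rewrite mulr_sumr; apply: eq_bigr => y _.
  rewrite dotF2_row_mx /signf /inner_product_fun row_mxKl row_mxKr.
  have -> : (-1) ^+ (dotF2 x y == 1) = chi (dotF2 x y).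
    by case: (dotF2 x y) => [[|[|k]]].
  by rewrite dotF2Dr !chiD !(dotF2C y); ring.
rewrite (bigD1 c) //= [X in _ + X]big1 ?addr0 => [|x xc].
  rewrite sum_chi addF2_eq0 eqxx mul1r normrM normrX normrN1 expr1n mul1r.
  by rewrite normrX addnn doubleK.
by rewrite sum_chi addF2_eq0 eq_sym (negPf xc) mul0r mulr0.
Qed.

Theorem proposition4 (n : nat) (n_ge2 : (2 <= n)%N) (n_even : ~~ odd n) :
  [/\ exists2 f : 'rV['F_2]_n -> bool,
        f 0 = false & walsh_loss f = 2 ^+ (3 * n) - 4 * 2 ^+ (2 * n),
      forall f : 'rV['F_2]_n -> bool,
        f 0 = false -> 2 ^+ (3 * n) - 4 * 2 ^+ (2 * n) <= walsh_loss f
    & forall f : 'rV['F_2]_n -> bool,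
        f 0 = false -> bent f ->
        walsh_loss f = 2 ^+ (3 * n) - 4 * 2 ^+ (2 * n)].
Proof.
split; [|by move=> f; apply: walsh_loss_ge|by move=> f; apply: bent_walsh_loss].
(* Rewriting [n] as [n./2 + n./2] makes the type of rows match the domain of [inner_product_fun]. *)
move: (n_even); rewrite -(even_halfK n_even) -addnn => mm_even.
have f0 : @inner_product_fun n./2 0 = false.
  by rewrite /inner_product_fun linear0 dotF2C dotF20r.
exists (@inner_product_fun n./2) => //.
exact: bent_walsh_loss mm_even f0 (@inner_product_bent _).
Qed.
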